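(* Let $F$ be a symmetric IEM on $[0,1)$ with reflection $R(x)=-x\bmod 1$, or a symmetric CEM on $\mathbb{R}/\mathbb{Z}$ with initial and final rotations $\theta_0,\theta_1$ and reflection $R(x)=-x+\theta_0+\theta_1\bmod 1$. Then every periodic interval $J$ of $F$ is symmetric: there exists $k\ge 0$ such that $R(J)=F^k(J)$ (equality of interiors).
   Context: A symmetric IEM is an interval exchange map on $[0,1)$ (a bijection that translates each of consecutive left-closed right-open elemental subintervals $J_1,\dots,J_d$) whose images appear in reversed order $F(J_d),\dots,F(J_1)$. A CEM on $\mathbb{R}/\mathbb{Z}$ with lengths $\lambda_1,\dots,\lambda_d>0$ ($\sum\lambda_i=1$), initial rotation $\theta_0$ and final rotation $\theta_1$ partitions the circle into consecutive arcs $J_1,\dots,J_d$ of lengths $\lambda_i$ starting at $\theta_0$, and maps $J_i$ by $x\mapsto x+\omega_i-\theta_0+\theta_1\bmod 1$, where $\omega$ is the translation vector of the IEM on $[0,1)$ with the same lengths and combinatorics; it is symmetric if it reverses the order of the arcs, i.e. $\omega_i=\sum_{j>i}\lambda_j-\sum_{j<i}\lambda_j$. A $q$-periodic interval (arc) $J$ is one for which $q$ is the least positive integer with $F^q(J)=J$, each $F^k(J)$ lies in a single elemental subinterval, and $J$ is maximal with these properties. *)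

(* Defs.v *)
(* concrete reals R. Points of R/Z are represented by their
   representatives in [0,1); frac_part x = x - floor x. *)
From Stdlib Require Import Reals.
Open Scope R_scope.

Fixpoint psum (lam : nat -> R) (n : nat) : R :=
  match n with
  | O => 0
  | S m => psum lam m + lam m
  end.

Definition lengths_ok (d : nat) (lam : nat -> R) : Prop :=
  (1 <= d)%nat /\ (forall i, (i < d)%nat -> 0 < lam i) /\ psum lam d = 1.

(* symmetric translation vector (0-based):
   omega_i = sum_{i<j<d} lam_j - sum_{j<i} lam_j *)
Definition omega (d : nat) (lam : nat -> R) (i : nat) : R :=
  (psum lam d - psum lam (S i)) - psum lam i.

Definition iem_piece (lam : nat -> R) (i : nat) (x : R) : Prop :=
  psum lam i <= x < psum lam (S i).

Definition cem_piece (lam : nat -> R) (th0 : R) (i : nat) (x : R) : Prop :=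
  0 <= x < 1 /\ psum lam i <= frac_part (x - th0) < psum lam (S i).

Definition is_sym_iem (d : nat) (lam : nat -> R) (F : R -> R) : Prop :=
  forall i x, (i < d)%nat -> iem_piece lam i x -> F x = x + omega d lam i.

Definition is_sym_cem (d : nat) (lam : nat -> R) (th0 th1 : R) (F : R -> R)
  : Prop :=
  forall i x, (i < d)%nat -> cem_piece lam th0 i x ->
    F x = frac_part (x + omega d lam i - th0 + th1).

Fixpoint fiter (n : nat) (f : R -> R) (x : R) : R :=
  match n with
  | O => x
  | S m => f (fiter m f x)
  end.

Definition img (f : R -> R) (A : R -> Prop) : R -> Prop :=
  fun y => exists x, A x /\ y = f x.

Definition subset (A B : R -> Prop) : Prop := forall x, A x -> B x.
Definition seteq (A B : R -> Prop) : Prop := forall x, A x <-> B x.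

Definition convex_set (A : R -> Prop) : Prop :=
  forall x y z, A x -> A z -> x <= y <= z -> A y.

Definition interval01 (J : R -> Prop) : Prop :=
  convex_set J /\ subset J (fun x => 0 <= x < 1).

(* an arc of R/Z (possibly the whole circle), as a set of representatives *)
Definition arc (J : R -> Prop) : Prop :=
  exists I, convex_set I /\ seteq J (img frac_part I).

Definition periodic_props (isint : (R -> Prop) -> Prop) (d : nat)
  (piece : nat -> R -> Prop) (F : R -> R) (J : R -> Prop) : Prop :=
  isint J /\ (exists x, J x) /\
  (exists q, (0 < q)%nat /\ seteq (img (fiter q F) J) J) /\
  (forall k, exists i, (i < d)%nat /\ subset (img (fiter k F) J) (piece i)).

Definition periodic_interval (isint : (R -> Prop) -> Prop) (d : nat)
  (piece : nat -> R -> Prop) (F : R -> R) (q : nat) (J : R -> Prop) : Prop :=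
  periodic_props isint d piece F J /\
  (0 < q)%nat /\ seteq (img (fiter q F) J) J /\
  (forall p, (0 < p)%nat -> seteq (img (fiter p F) J) J -> (q <= p)%nat) /\
  (forall J', periodic_props isint d piece F J' -> subset J J' -> seteq J' J).

Definition rinterior (A : R -> Prop) (x : R) : Prop :=
  exists e, 0 < e /\ forall y, Rabs (y - x) < e -> A y.

Definition lift (S : R -> Prop) : R -> Prop := fun x => S (frac_part x).

Definition circle_interior (S : R -> Prop) : R -> Prop := rinterior (lift S).

Definition iem_refl (x : R) : R := frac_part (- x).
Definition cem_refl (th0 th1 : R) (x : R) : R := frac_part (- x + th0 + th1).

(* Main.v *)
(** In the circle, [F] is the composition [R o S] of two reflections, where [S] reverses
    each elemental arc.  Let [u_k] be the centre of [F^k(J)] and [y_k = S(u_k)]; the [y_k]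
    are the centres of the images of [R(J)], and [y_k] lies in the same elemental arc as
    [u_k].  The function [E], which jumps by [+1] at each [u_k] and by [-1] at each [y_k],
    is therefore invariant under [S] and [R], hence under [F], and it takes the same value
    at every break point.  By maximality the orbit of each endpoint of [J] meets a break
    point, so [E] agrees at the two ends of [J]; as [E] jumps up at the centre of [J], some
    [y_k] lies in the closure of [J].  Two overlapping maximal periodic arcs of the same
    length coincide, so [R(F^(k+1)(J))] and [J] have the same centre. *)
Require Import Defs.
From Stdlib Require Import Reals Lra Lia ZArith ClassicalEpsilon.
Open Scope R_scope.

(** * Congruence modulo 1 and representatives in [[0,1)] *)

Definition cong (a b : R) : Prop := exists m : Z, a = b + IZR m.

Lemma cong_refl (a : R) : cong a a.
Proof. exists 0%Z; simpl; lra. Qed.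

Lemma cong_sym (a b : R) : cong a b -> cong b a.
Proof. intros [m Hm]; exists (- m)%Z; rewrite opp_IZR; lra. Qed.

Lemma cong_trans (a b c : R) : cong a b -> cong b c -> cong a c.
Proof. intros [m Hm] [n Hn]; exists (m + n)%Z; rewrite plus_IZR; lra. Qed.

Lemma cong_plus (a b c e : R) : cong a b -> cong c e -> cong (a + c) (b + e).
Proof. intros [m Hm] [n Hn]; exists (m + n)%Z; rewrite plus_IZR; lra. Qed.

Lemma cong_opp (a b : R) : cong a b -> cong (- a) (- b).
Proof. intros [m Hm]; exists (- m)%Z; rewrite opp_IZR; lra. Qed.

Lemma cong_minus (a b c e : R) : cong a b -> cong c e -> cong (a - c) (b - e).
Proof. intros H1 H2; apply cong_plus; [exact H1 | apply cong_opp; exact H2]. Qed.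

Lemma IZR_abs_lt1 (m : Z) : -1 < IZR m < 1 -> m = 0%Z.
Proof.
  intros [H1 H2].
  apply lt_IZR in H1; apply lt_IZR in H2; lia.
Qed.

Lemma cong_eq (a b : R) : cong a b -> -1 < a - b < 1 -> a = b.
Proof.
  intros [m Hm] Hd.
  assert (Hz : m = 0%Z) by (apply IZR_abs_lt1; lra).
  subst m; simpl in Hm; lra.
Qed.

Lemma frac_bounds (a : R) : 0 <= frac_part a < 1.
Proof. destruct (base_fp a); lra. Qed.

Lemma frac_cong (a : R) : cong (frac_part a) a.
Proof. exists (- Int_part a)%Z; unfold frac_part; rewrite opp_IZR; lra. Qed.

Lemma frac_eq (a r : R) : 0 <= r < 1 -> cong r a -> frac_part a = r.
Proof.
  intros Hr Hc; apply cong_eq.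
  - apply cong_trans with a; [apply frac_cong | apply cong_sym; exact Hc].
  - pose proof (frac_bounds a); lra.
Qed.

Lemma cong_frac (a b : R) : cong a b -> frac_part a = frac_part b.
Proof.
  intros H; apply frac_eq; [apply frac_bounds |].
  apply cong_trans with b; [apply frac_cong | apply cong_sym; exact H].
Qed.

Lemma frac_cong_inv (a b : R) : frac_part a = frac_part b -> cong a b.
Proof.
  intros H; apply cong_trans with (frac_part a);
    [apply cong_sym, frac_cong | rewrite H; apply frac_cong].
Qed.

Lemma frac_id (a : R) : 0 <= a < 1 -> frac_part a = a.
Proof. intros H; apply frac_eq; [exact H | apply cong_refl]. Qed.

(** * The sawtooth function and the window that counts points of an arc *)

(* The odd sawtooth: [a - 1/2] on [(0,1)] and [0] at the integers.  Oddness at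
   the jumps is what makes the crossing sum below exactly invariant. *)
Definition saw (a : R) : R := (frac_part a - frac_part (- a)) / 2.

Lemma saw_opp (a : R) : saw (- a) = - saw a.
Proof. unfold saw; rewrite Ropp_involutive; lra. Qed.

Lemma saw_cong (a b : R) : cong a b -> saw a = saw b.
Proof.
  intros H; unfold saw.
  rewrite (cong_frac a b H), (cong_frac (- a) (- b) (cong_opp a b H)); reflexivity.
Qed.

Lemma saw_pos (a : R) : 0 < a < 1 -> saw a = a - 1 / 2.
Proof.
  intros H; unfold saw.
  rewrite (frac_id a) by lra.
  rewrite (frac_eq (- a) (1 - a)); [lra | lra | exists 1%Z; lra].
Qed.

Lemma saw_neg (a : R) : -1 < a < 0 -> saw a = a + 1 / 2.
Proof.
  intros H; replace a with (- - a) by lra.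
  rewrite saw_opp, saw_pos; lra.
Qed.

Lemma saw_0 : saw 0 = 0.
Proof. unfold saw; rewrite Ropp_0; lra. Qed.

(** For [0 < 2 * h < 1] this is the indicator of the arc [|s| < h] modulo 1, with value 1/2 at its
    two endpoints: away from the jumps, the linear parts of the sawtooths cancel against [2 * h]. *)
Definition window (h s : R) : R := 2 * h - saw (s + h) + saw (s - h).

Lemma window_0 (h : R) : 0 < h < 1 -> window h 0 = 1.
Proof.
  intros H; unfold window.
  rewrite saw_pos by lra; rewrite saw_neg by lra; lra.
Qed.

Lemma window_cases (h s : R) : 0 < h -> 2 * h < 1 ->
  (0 <= window h s /\ exists e, cong e s /\ - h <= e <= h) \/ window h s = 0.
Proof.
  intros H0 H1.
  assert (Hw : window h s = window h (frac_part s)).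
  { unfold window.
    rewrite (saw_cong (s + h) (frac_part s + h)), (saw_cong (s - h) (frac_part s - h));
      [reflexivity | |];
      (apply cong_plus || apply cong_minus);
      try apply cong_refl; apply cong_sym, frac_cong. }
  rewrite Hw.
  pose proof (frac_bounds s) as Hb; pose proof (frac_cong s) as Hc.
  set (r := frac_part s) in *; unfold window.
  destruct (Rtotal_order r h) as [Hlt | [Heq | Hgt]].
  - left; split; [| exists r; split; [exact Hc | lra]].
    rewrite saw_pos by lra; rewrite saw_neg by lra; lra.
  - left; split; [| exists r; split; [exact Hc | lra]].
    rewrite saw_pos by lra; replace (r - h) with 0 by lra; rewrite saw_0; lra.
  - rewrite (saw_pos (r - h)) by lra.
    destruct (Rlt_le_dec r (1 - h)) as [Hr | Hr].
    + right; rewrite saw_pos by lra; lra.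
    (* A representative [r >= 1 - h] stands for [r - 1], in the left half of the arc. *)
    + left; split.
      * rewrite (saw_cong (r + h) (r + h - 1)) by (exists 1%Z; lra).
        destruct (Req_dec r (1 - h)) as [He | He].
        -- replace (r + h - 1) with 0 by lra; rewrite saw_0; lra.
        -- rewrite saw_pos by lra; lra.
      * exists (r - 1); split; [| lra].
        apply cong_trans with r; [exists (-1)%Z; lra | exact Hc].
Qed.

(** * Partial sums, and the positions of the elemental arcs *)

Lemma psum_ext (f g : nat -> R) (n : nat) :
  (forall k, f k = g k) -> psum f n = psum g n.
Proof. intros H; induction n as [|n IH]; simpl; [reflexivity | rewrite IH, H; reflexivity]. Qed.

Lemma psum_minus (f g : nat -> R) (n : nat) :
  psum (fun k => f k - g k) n = psum f n - psum g n.
Proof. induction n as [|n IH]; simpl; [lra | rewrite IH; lra]. Qed.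

Lemma psum_opp (f : nat -> R) (n : nat) : psum (fun k => - f k) n = - psum f n.
Proof. induction n as [|n IH]; simpl; [lra | rewrite IH; lra]. Qed.

Lemma psum_shift (f : nat -> R) (n : nat) :
  f n = f 0%nat -> psum (fun k => f (S k)) n = psum f n.
Proof.
  intros H.
  assert (G : forall m, psum (fun k => f (S k)) m = psum f m + f m - f 0%nat)
    by (induction m as [|m IH]; simpl; [lra | rewrite IH; lra]).
  rewrite G; lra.
Qed.

Lemma psum_ge_first (f : nat -> R) (n : nat) :
  (0 < n)%nat -> (forall k, 0 <= f k) -> f 0%nat <= psum f n.
Proof.
  intros Hn H; destruct n as [|n]; [lia |]; clear Hn.
  induction n as [|n IH]; [simpl; lra |].
  change (psum f (S (S n))) with (psum f (S n) + f (S n)).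
  specialize (H (S n)); lra.
Qed.

Lemma psum_mono (d : nat) (lam : nat -> R) (i j : nat) :
  lengths_ok d lam -> (i <= j <= d)%nat -> psum lam i <= psum lam j.
Proof.
  intros (_ & Hp & _) [Hij Hjd]; induction Hij as [|j Hij IH]; [lra |].
  assert (psum lam i <= psum lam j) by (apply IH; lia).
  specialize (Hp j ltac:(lia)); simpl; lra.
Qed.

Lemma psum_bounds (d : nat) (lam : nat -> R) (i : nat) :
  lengths_ok d lam -> (i <= d)%nat -> 0 <= psum lam i <= 1.
Proof.
  intros Hl Hi; split.
  - apply (psum_mono d lam 0 i Hl); lia.
  - destruct Hl as (H1 & H2 & H3); rewrite <- H3.
    apply (psum_mono d); [split; auto | lia].
Qed.

Lemma omega_eq (d : nat) (lam : nat -> R) (i : nat) :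
  lengths_ok d lam -> omega d lam i = 1 - psum lam i - psum lam (S i).
Proof. intros (_ & _ & H); unfold omega; lra. Qed.

(** * Centred cycles and the invariance of the crossing sum *)

(* [i k] and [u k] are the arc containing the [k]-th image of a periodic arc of
   length [2 h] and the centre of that image, lifted to [[th0, th0 + 1)]. *)
Record centered_cycle (d : nat) (lam : nat -> R) (th0 th1 : R) (q : nat) (h : R)
  (i : nat -> nat) (u : nat -> R) : Prop := {
  cc_q : (0 < q)%nat;
  cc_h : 0 < h;
  cc_h1 : 2 * h < 1;
  cc_i : forall k, (i k < d)%nat;
  cc_lo : forall k, th0 + psum lam (i k) <= u k - h;
  cc_hi : forall k, u k + h <= th0 + psum lam (S (i k));
  cc_step : forall k, cong (u (S k)) (u k + omega d lam (i k) - th0 + th1);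
  cc_uper : forall k, u (k + q)%nat = u k;
  cc_iper : forall k, i (k + q)%nat = i k;
  cc_left : exists k, th0 + psum lam (i k) = u k - h;
  cc_right : exists k, u k + h = th0 + psum lam (S (i k)) }.

(** The reflection in the midpoint of the [i]-th elemental arc, acting on lifts to
    [[th0, th0 + 1]]. *)
Definition mirror (lam : nat -> R) (th0 : R) (i : nat) (t : R) : R :=
  2 * th0 + psum lam i + psum lam (S i) - t.

(** Since [saw (t - c)] drops by 1 as [t] increases through [c] and has slope 1 elsewhere, each term
    jumps up at [u k], down at its mirror image, and is locally constant otherwise. *)
Definition crossing (lam : nat -> R) (th0 : R) (q : nat) (i : nat -> nat)
  (u : nat -> R) (t : R) : R :=
  psum (fun k => saw (t - mirror lam th0 (i k) (u k)) - saw (t - u k)) q.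

Lemma crossing_cong lam th0 q i u (s t : R) :
  cong s t -> crossing lam th0 q i u s = crossing lam th0 q i u t.
Proof.
  intros H; apply psum_ext; intros k; f_equal;
    apply saw_cong, cong_minus; auto using cong_refl.
Qed.

Lemma arc_disjoint (d : nat) (lam : nat -> R) (i j : nat) (s t : R) :
  lengths_ok d lam -> (i < d)%nat -> (j < d)%nat ->
  psum lam i <= s -> t <= psum lam (S j) -> s < t -> (i <= j)%nat.
Proof.
  intros Hl Hi Hj H1 H2 H3.
  destruct (Nat.le_gt_cases i j) as [H | H]; [exact H | exfalso].
  pose proof (psum_mono d lam (S j) i Hl ltac:(lia)); lra.
Qed.

Section Cycle.
Context (d : nat) (lam : nat -> R) (th0 th1 : R) (q : nat) (h : R)
  (i : nat -> nat) (u : nat -> R).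
Context (Hl : lengths_ok d lam) (Hc : centered_cycle d lam th0 th1 q h i u).

Let y (k : nat) : R := mirror lam th0 (i k) (u k).
Let E : R -> R := crossing lam th0 q i u.

(** By [omega_eq], translating an arc agrees modulo 1 with its mirror followed by the reflection
    [x -> th0 + th1 - x]. *)
Lemma cycle_reflect (k : nat) : cong (u (S k)) (th0 + th1 - y k).
Proof.
  apply cong_trans with (1 := cc_step _ _ _ _ _ _ _ _ Hc k).
  rewrite (omega_eq d lam (i k) Hl); exists 1%Z; unfold y, mirror; lra.
Qed.

(** The reflection exchanges [y k] and [u (S k)] modulo 1. It swaps up and down jumps while
    reversing orientation, and the two signs cancel by oddness of [saw]; periodicity of [u] permits
    the shift of index. *)
Lemma crossing_reflect (t : R) : E (th0 + th1 - t) = E t.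
Proof.
  unfold E, crossing; rewrite !psum_minus.
  rewrite <- (psum_shift (fun k => saw (th0 + th1 - t - u k))),
    <- (psum_shift (fun k => saw (t - u k)));
    try (f_equal; f_equal; apply (cc_uper _ _ _ _ _ _ _ _ Hc 0)).
  rewrite (psum_ext (fun k => saw (th0 + th1 - t - mirror lam th0 (i k) (u k)))
    (fun k => - saw (t - u (S k)))).
  2:{ intros k; rewrite <- saw_opp; apply saw_cong.
      replace (- (t - u (S k))) with (u (S k) - t) by lra.
      replace (th0 + th1 - t - mirror lam th0 (i k) (u k))
        with (th0 + th1 - y k - t) by (unfold y; lra).
      apply cong_minus; [apply cong_sym, cycle_reflect | apply cong_refl]. }
  rewrite (psum_ext (fun k => saw (th0 + th1 - t - u (S k)))
    (fun k => - saw (t - mirror lam th0 (i k) (u k)))).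
  2:{ intros k; rewrite <- saw_opp; apply saw_cong.
      replace (- (t - mirror lam th0 (i k) (u k)))
        with (th0 + th1 - t - (th0 + th1 - y k)) by (unfold y; lra).
      apply cong_minus; [apply cong_refl | apply cycle_reflect]. }
  rewrite !psum_opp; lra.
Qed.

Lemma centre_bounds (k : nat) :
  th0 + psum lam (i k) + h <= u k <= th0 + psum lam (S (i k)) - h.
Proof.
  pose proof (cc_lo _ _ _ _ _ _ _ _ Hc k); pose proof (cc_hi _ _ _ _ _ _ _ _ Hc k); lra.
Qed.

Lemma mirror_bounds (k : nat) :
  th0 + psum lam (i k) + h <= y k <= th0 + psum lam (S (i k)) - h.
Proof. pose proof (centre_bounds k); unfold y, mirror; lra. Qed.

(** [u k] and [y k] keep distance [h] from the ends of their elemental arc, so a [t] outside its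
    interior sees both on the same linear branch of the sawtooth. *)
Lemma crossing_term_far (k : nat) (t : R) :
  th0 <= t <= th0 + 1 ->
  t <= th0 + psum lam (i k) \/ th0 + psum lam (S (i k)) <= t ->
  saw (t - y k) - saw (t - u k) = u k - y k.
Proof.
  intros Ht Hor.
  pose proof (centre_bounds k); pose proof (mirror_bounds k).
  pose proof (cc_h _ _ _ _ _ _ _ _ Hc); pose proof (cc_i _ _ _ _ _ _ _ _ Hc k) as Hi.
  pose proof (psum_bounds d lam (i k) Hl ltac:(lia)).
  pose proof (psum_bounds d lam (S (i k)) Hl ltac:(lia)).
  destruct Hor; [rewrite !saw_neg by lra | rewrite !saw_pos by lra]; lra.
Qed.

(** A break point is never interior to an elemental arc, so every term has its far value, which does
    not depend on [j]. *)
Lemma crossing_break (j : nat) : (j <= d)%nat ->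
  E (th0 + psum lam j) = psum (fun k => u k - y k) q.
Proof.
  intros Hj; apply psum_ext; intros k; apply crossing_term_far.
  - pose proof (psum_bounds d lam j Hl Hj); lra.
  - pose proof (cc_i _ _ _ _ _ _ _ _ Hc k) as Hi.
    destruct (Nat.le_gt_cases j (i k)).
    + left; pose proof (psum_mono d lam j (i k) Hl ltac:(lia)); lra.
    + right; pose proof (psum_mono d lam (S (i k)) j Hl ltac:(lia)); lra.
Qed.

(** In terms centred in arc [j] the mirror exchanges [u k] and [y k], and oddness restores the sign;
    all other terms are constant on this arc. *)
Lemma crossing_mirror (j : nat) (t : R) : (j < d)%nat ->
  th0 + psum lam j <= t <= th0 + psum lam (S j) -> E (mirror lam th0 j t) = E t.
Proof.
  intros Hj Ht; apply psum_ext; intros k.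
  destruct (Nat.eq_dec (i k) j) as [He | Hne].
  - rewrite He.
    replace (mirror lam th0 j t - mirror lam th0 j (u k)) with (- (t - u k))
      by (unfold mirror; lra).
    replace (mirror lam th0 j t - u k) with (- (t - mirror lam th0 j (u k)))
      by (unfold mirror; lra).
    rewrite !saw_opp; lra.
  - fold (y k).
    pose proof (cc_i _ _ _ _ _ _ _ _ Hc k) as Hi.
    pose proof (psum_bounds d lam j Hl ltac:(lia)).
    pose proof (psum_bounds d lam (S j) Hl ltac:(lia)).
    assert (Hfar : forall s, th0 + psum lam j <= s <= th0 + psum lam (S j) ->
      saw (s - y k) - saw (s - u k) = u k - y k).
    { intros s Hs; apply crossing_term_far; [lra |].
      destruct (Nat.le_gt_cases j (i k)).
      - left; pose proof (psum_mono d lam (S j) (i k) Hl ltac:(lia)); lra.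
      - right; pose proof (psum_mono d lam (S (i k)) j Hl ltac:(lia)); lra. }
    rewrite !Hfar; [lra | lra | unfold mirror; lra].
Qed.

(** Mirror followed by reflection is the map itself. The closed image arc lies in one closed
    elemental arc, so a single mirror serves every offset [e]. *)
Lemma crossing_step (k : nat) (e : R) : - h <= e <= h -> E (u (S k) + e) = E (u k + e).
Proof.
  intros He.
  pose proof (centre_bounds k).
  rewrite <- (crossing_mirror (i k) (u k + e)); [| apply (cc_i _ _ _ _ _ _ _ _ Hc) | lra].
  rewrite <- (crossing_reflect (mirror lam th0 (i k) (u k + e))).
  apply crossing_cong.
  replace (th0 + th1 - mirror lam th0 (i k) (u k + e)) with (th0 + th1 - y k + e)
    by (unfold y, mirror; lra).
  apply cong_plus; [apply cycle_reflect | apply cong_refl].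
Qed.

Lemma crossing_const (k : nat) (e : R) : - h <= e <= h -> E (u k + e) = E (u 0%nat + e).
Proof.
  intros He; induction k as [|k IH]; [reflexivity | rewrite crossing_step; auto].
Qed.

(* A maximal cycle touches a break point on either side, so the crossing sum
   takes the same value at both ends of the central arc. *)
Lemma crossing_ends : E (u 0%nat - h) = E (u 0%nat + h).
Proof.
  pose proof (cc_h _ _ _ _ _ _ _ _ Hc).
  destruct (cc_left _ _ _ _ _ _ _ _ Hc) as [k Hk].
  destruct (cc_right _ _ _ _ _ _ _ _ Hc) as [k' Hk'].
  pose proof (cc_i _ _ _ _ _ _ _ _ Hc) as Hi.
  rewrite <- (crossing_const k' h) by lra.
  unfold Rminus; rewrite <- (crossing_const k (- h)) by lra.
  fold (u k - h); rewrite Hk', <- Hk, !crossing_break; auto.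
  - apply Hi.
  - pose proof (Hi k); lia.
Qed.

(** The increment of [E] across the arc counts the [u k] in it minus the [y k] in it, endpoints
    counting one half. It vanishes by [crossing_ends], while [u 0] contributes 1, so some [y k] must
    compensate. *)
Lemma mirror_near_centre :
  exists k e, cong (y k) (u 0%nat + e) /\ - h <= e <= h.
Proof.
  pose proof (cc_h _ _ _ _ _ _ _ _ Hc) as H0.
  pose proof (cc_h1 _ _ _ _ _ _ _ _ Hc) as H1.
  destruct (classic (exists k e, cong (y k) (u 0%nat + e) /\ - h <= e <= h))
    as [H | Hno]; [exact H | exfalso].
  assert (Hy : forall k, window h (u 0%nat - y k) = 0).
  { intros k; destruct (window_cases h (u 0%nat - y k) H0 H1)
      as [[_ (e & Hce & He)] | Hz]; [| exact Hz].
    exfalso; apply Hno; exists k, (- e); split; [| lra].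
    destruct Hce as [m Hm]; exists m; lra. }
  assert (Hu : forall k, 0 <= window h (u 0%nat - u k)).
  { intros k; destruct (window_cases h (u 0%nat - u k) H0 H1) as [[Hp _] | Hz]; lra. }
  pose proof (psum_ge_first (fun k => window h (u 0%nat - u k)) q
    (cc_q _ _ _ _ _ _ _ _ Hc) Hu) as Hge; cbv beta in Hge.
  replace (u 0%nat - u 0%nat) with 0 in Hge by lra.
  rewrite window_0 in Hge by lra.
  assert (Hz : psum (fun k => window h (u 0%nat - u k)) q
             = E (u 0%nat + h) - E (u 0%nat - h)).
  { unfold E, crossing; rewrite <- psum_minus; apply psum_ext; intros k; fold (y k).
    specialize (Hy k); unfold window in *.
    replace (u 0%nat + h - y k) with (u 0%nat - y k + h) by lra.
    replace (u 0%nat - h - y k) with (u 0%nat - y k - h) by lra.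
    replace (u 0%nat + h - u k) with (u 0%nat - u k + h) by lra.
    replace (u 0%nat - h - u k) with (u 0%nat - u k - h) by lra.
    lra. }
  rewrite crossing_ends in Hz; lra.
Qed.

(** The margin [h] around [y l] rules out a difference of a full turn. The arcs of radius [h] about
    [y l] and [u k] then overlap, as [|e| < 2 * h], which forces a common elemental arc. *)
Lemma near_same_arc (k l : nat) (e : R) :
  cong (y l) (u k + e) -> - h <= e <= h -> y l = u k + e /\ i l = i k.
Proof.
  intros Hce He.
  pose proof (centre_bounds k); pose proof (mirror_bounds l).
  pose proof (cc_h _ _ _ _ _ _ _ _ Hc) as Hh.
  pose proof (cc_h1 _ _ _ _ _ _ _ _ Hc) as Hh1.
  pose proof (cc_i _ _ _ _ _ _ _ _ Hc k) as Hik.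
  pose proof (cc_i _ _ _ _ _ _ _ _ Hc l) as Hil.
  pose proof (psum_bounds d lam (i k) Hl ltac:(lia)).
  pose proof (psum_bounds d lam (S (i k)) Hl ltac:(lia)).
  pose proof (psum_bounds d lam (i l) Hl ltac:(lia)).
  pose proof (psum_bounds d lam (S (i l)) Hl ltac:(lia)).
  assert (Heq : y l = u k + e) by (apply cong_eq; [exact Hce | lra]).
  split; [exact Heq |].
  apply Nat.le_antisymm.
  - apply (arc_disjoint d lam _ _ (y l - h - th0) (u k + h - th0)); auto; lra.
  - apply (arc_disjoint d lam _ _ (u k - h - th0) (y l + h - th0)); auto; lra.
Qed.

Lemma cycle_add_mul (n k : nat) : u (k + n * q)%nat = u k /\ i (k + n * q)%nat = i k.
Proof.
  induction n as [|n [IH1 IH2]]; simpl.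
  - rewrite Nat.add_0_r; auto.
  - replace (k + (q + n * q))%nat with (k + n * q + q)%nat by lia.
    rewrite (cc_uper _ _ _ _ _ _ _ _ Hc), (cc_iper _ _ _ _ _ _ _ _ Hc); auto.
Qed.

(* The mirror orbit runs backwards: [y (S l)] is mapped to [y l]. *)
Lemma mirror_follows (K : nat) (e : R) : - h <= e <= h -> cong (y K) (u 0%nat + e) ->
  forall j l, (j + l)%nat = K -> cong (y l) (u j + e).
Proof.
  intros He H0; induction j as [|j IH]; intros l Hjl; [simpl in Hjl; subst; exact H0 |].
  specialize (IH (S l) ltac:(lia)).
  destruct (near_same_arc j (S l) e IH He) as [Hy Hi].
  pose proof (cc_step _ _ _ _ _ _ _ _ Hc j) as [m Hm].
  pose proof (cycle_reflect l) as [n Hn].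
  rewrite <- Hi, (omega_eq d lam (i (S l)) Hl) in Hm.
  unfold y at 1, mirror in Hy.
  exists (n - m - 1)%Z; rewrite !minus_IZR; lra.
Qed.

Lemma cycle_symmetric : exists k, cong (u k) (th0 + th1 - u 0%nat).
Proof.
  destruct mirror_near_centre as (k & e & Hce & He).
  pose proof (cc_h _ _ _ _ _ _ _ _ Hc) as Hh.
  (* The mirror orbit runs backwards, so the index drops by [j]; adding [j] periods changes nothing
     and keeps the natural subtraction from truncating. *)
  assert (Hall : forall j, exists l, y l = u j + e /\ i l = i j).
  { intros j; exists (k + j * q - j)%nat.
    pose proof (cc_q _ _ _ _ _ _ _ _ Hc).
    apply near_same_arc; [| exact He].
    apply (mirror_follows (k + j * q)); [exact He | | nia].
    unfold y; destruct (cycle_add_mul j k) as [-> ->]; exact Hce. }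
  destruct (cc_left _ _ _ _ _ _ _ _ Hc) as [a Ha].
  destruct (cc_right _ _ _ _ _ _ _ _ Hc) as [b Hb].
  destruct (Hall a) as (la & Hla & Hia), (Hall b) as (lb & Hlb & Hib).
  pose proof (mirror_bounds la) as Ba; pose proof (mirror_bounds lb) as Bb.
  rewrite Hia in Ba; rewrite Hib in Bb.
  (* At the index [a] touching a break point on the left, [y la] cannot lie left of [u a], so
     [e >= 0]; the touch on the right at [b] gives [e <= 0]. *)
  assert (e = 0) by lra; subst e.
  exists (S k); apply cong_trans with (1 := cycle_reflect k).
  destruct Hce as [m Hm]; exists (- m)%Z; rewrite opp_IZR; lra.
Qed.

End Cycle.

(** * From a maximal periodic arc to a centred cycle *)

Lemma fiter_add (f : R -> R) (k n : nat) (x : R) :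
  fiter (k + n) f x = fiter k f (fiter n f x).
Proof. induction k as [|k IH]; simpl; [reflexivity | rewrite IH; reflexivity]. Qed.

Lemma arc_length_lt1 (d : nat) (lam : nat -> R) (i : nat) :
  lengths_ok d lam -> (2 <= d)%nat -> (i < d)%nat -> psum lam (S i) - psum lam i < 1.
Proof.
  intros Hl Hd Hi.
  pose proof Hl as (_ & Hp & _).
  pose proof (Hp 0%nat ltac:(lia)) as H0; pose proof (Hp 1%nat ltac:(lia)) as H1.
  destruct i as [|i].
  - pose proof (psum_bounds d lam 2 Hl Hd) as H; simpl in *; lra.
  - pose proof (psum_mono d lam 1 (S i) Hl ltac:(lia)) as H; simpl psum at 1 in H.
    pose proof (psum_bounds d lam (S (S i)) Hl ltac:(lia)); lra.
Qed.

(** With at least two arcs, the lifts of one elemental arc are separated by gaps of positive length,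
    and the convex set [K], which meets one lift, cannot jump across a gap. *)
Lemma convex_in_arc (d : nat) (lam : nat -> R) (th0 : R) (i : nat) (K : R -> Prop) (w : R) :
  lengths_ok d lam -> (2 <= d)%nat -> (i < d)%nat -> convex_set K ->
  (forall z, K z -> psum lam i <= frac_part (z - th0) < psum lam (S i)) ->
  K w -> th0 + psum lam i <= w < th0 + psum lam (S i) ->
  forall z, K z -> th0 + psum lam i <= z < th0 + psum lam (S i).
Proof.
  intros Hl Hd Hi HK HP Hw Hwb z Hz.
  pose proof (arc_length_lt1 d lam i Hl Hd Hi) as Hlen.
  pose proof (psum_bounds d lam i Hl ltac:(lia)) as B0.
  pose proof (psum_bounds d lam (S i) Hl ltac:(lia)) as B1.
  split.
  - destruct (Rle_lt_dec (th0 + psum lam i) z) as [H | H]; [exact H | exfalso].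
    (* A point of [K] in the gap on the left, whether [z] lies in that gap or beyond it. *)
    set (s := Rmax z (th0 + psum lam (S i) - 1)).
    assert (Hs : z <= s /\ th0 + psum lam (S i) - 1 <= s /\ s < th0 + psum lam i)
      by (split; [apply Rmax_l | split; [apply Rmax_r | apply Rmax_lub_lt; lra]]).
    pose proof (HP s (HK z s w Hz Hw ltac:(lra))) as Hfs.
    destruct (Rle_lt_dec 0 (s - th0)).
    + rewrite frac_id in Hfs; lra.
    + rewrite (frac_eq (s - th0) (s - th0 + 1)) in Hfs; [lra | lra | exists 1%Z; lra].
  - destruct (Rlt_le_dec z (th0 + psum lam (S i))) as [H | H]; [exact H | exfalso].
    pose proof (HP _ (HK w (th0 + psum lam (S i)) z Hw Hz ltac:(lra))) as Hfs.
    replace (th0 + psum lam (S i) - th0) with (psum lam (S i)) in Hfs by lra.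
    destruct (Rle_lt_dec 1 (psum lam (S i))).
    + rewrite (frac_eq _ 0) in Hfs; [lra | lra | exists (-1)%Z; lra].
    + rewrite frac_id in Hfs; lra.
Qed.

(* Points just beyond [sup I - T] would have to wrap around the whole circle. *)
Lemma short_arc_not_rotated (I : R -> Prop) (A B T z0 : R) :
  convex_set I -> B - A < 1 -> (forall z, I z -> A <= z < B) ->
  I z0 -> I (z0 + T) -> 0 < T ->
  (forall z, I z -> exists z', I z' /\ cong (z + T) z') -> False.
Proof.
  intros HI HAB Hb H0 HT0 HT Hrot.
  destruct (completeness I) as [b [Hub Hlub]].
  { exists B; intros z Hz; apply Hb in Hz; lra. }
  { exists z0; exact H0. }
  assert (HbB : b <= B) by (apply Hlub; intros z Hz; apply Hb in Hz; lra).
  pose proof (Hub _ HT0) as HTb.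
  (* [e < T] keeps [z = b - T + e] below the supremum [b]; [e < 1 - (B - A)] makes [z + T = b + e]
     fall short of [A] after subtracting a full turn. *)
  set (e := Rmin T (1 - (B - A)) / 2).
  assert (He : 0 < e /\ e < T /\ e < 1 - (B - A)).
  { unfold e; pose proof (Rmin_l T (1 - (B - A))); pose proof (Rmin_r T (1 - (B - A))).
    assert (0 < Rmin T (1 - (B - A))) by (apply Rmin_glb_lt; lra); lra. }
  set (z := b - T + e).
  assert (Hw : exists w, I w /\ z < w).
  { destruct (classic (exists w, I w /\ z < w)) as [H | H]; [exact H | exfalso].
    assert (b <= z); [| unfold z in *; lra].
    apply Hlub; intros w Hw; apply Rnot_lt_le; intros Hlt; apply H; exists w; auto. }
  destruct Hw as (w & Hw & Hzw).
  assert (Hz : I z) by (apply (HI z0 z w); auto; unfold z in *; lra).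
  destruct (Hrot z Hz) as (z' & Hz' & m & Hm).
  pose proof (Hub _ Hz') as Hz'b; pose proof (Hb _ Hz') as Hz'A.
  assert (Hm0 : 0 < IZR m) by (unfold z in *; lra).
  apply lt_IZR in Hm0.
  assert (1 <= IZR m) by (apply IZR_le; lia).
  unfold z in *; lra.
Qed.

(** A negative [T] is handled by the inverse rotation, based at [z0 + T]. Applied to [F^q] on [J],
    this upgrades setwise to pointwise periodicity. *)
Lemma invariant_arc_fixed (I : R -> Prop) (A B T z0 : R) :
  convex_set I -> B - A < 1 -> (forall z, I z -> A <= z < B) ->
  I z0 -> I (z0 + T) ->
  (forall z, I z -> exists z', I z' /\ cong (z + T) z') ->
  (forall z', I z' -> exists z, I z /\ cong (z + T) z') -> T = 0.
Proof.
  intros HI HAB Hb H0 HT Hf Hg.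
  destruct (Rtotal_order T 0) as [H | [H | H]]; [exfalso | exact H | exfalso].
  - apply (short_arc_not_rotated I A B (- T) (z0 + T)); auto; [| lra |].
    + replace (z0 + T + - T) with z0 by lra; exact H0.
    + intros z Hz; destruct (Hg z Hz) as (z' & Hz' & m & Hm).
      exists z'; split; [exact Hz' |]; exists (- m)%Z; rewrite opp_IZR; lra.
  - apply (short_arc_not_rotated I A B T z0); auto.
Qed.

Lemma argmin_upto (f : nat -> R) (q : nat) : (0 < q)%nat ->
  exists k, forall j, (j < q)%nat -> f k <= f j.
Proof.
  intros Hq; induction q as [|q IH]; [lia |].
  destruct q as [|q].
  - exists 0%nat; intros j Hj; replace j with 0%nat by lia; lra.
  - destruct (IH ltac:(lia)) as [k Hk].
    destruct (Rle_lt_dec (f k) (f (S q))) as [H | H].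
    + exists k; intros j Hj; destruct (Nat.eq_dec j (S q)) as [-> | Hne];
        [exact H | apply Hk; lia].
    + exists (S q); intros j Hj; destruct (Nat.eq_dec j (S q)) as [-> | Hne]; [lra |].
      specialize (Hk j ltac:(lia)); lra.
Qed.

Lemma argmin_periodic (f : nat -> R) (q : nat) : (0 < q)%nat ->
  (forall k, f (k + q)%nat = f k) -> exists k, forall j, f k <= f j.
Proof.
  intros Hq Hper; destruct (argmin_upto f q Hq) as [k Hk]; exists k; intros j.
  assert (Hm : forall n r, f (r + n * q)%nat = f r).
  { induction n as [|n IH]; intros r; simpl; [f_equal; lia |].
    replace (r + (q + n * q))%nat with (r + n * q + q)%nat by lia; rewrite Hper; auto. }
  rewrite (Nat.div_mod_eq j q), Nat.add_comm, Nat.mul_comm, Hm.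
  apply Hk, Nat.mod_upper_bound; lia.
Qed.

Lemma cem_piece_lift (d : nat) (lam : nat -> R) (th0 : R) (i : nat) (t : R) :
  lengths_ok d lam -> (i < d)%nat -> th0 + psum lam i <= t < th0 + psum lam (S i) ->
  cem_piece lam th0 i (frac_part t).
Proof.
  intros Hl Hi Ht; split; [apply frac_bounds |].
  pose proof (psum_bounds d lam i Hl ltac:(lia)).
  pose proof (psum_bounds d lam (S i) Hl ltac:(lia)).
  rewrite (cong_frac _ (t - th0)) by (apply cong_minus; [apply frac_cong | apply cong_refl]).
  rewrite frac_id; lra.
Qed.

(** Points sharing the itinerary of [z0] are moved by the same translations. This controls the orbit
    of an arc larger than the given periodic one. *)
Lemma cem_orbit (d : nat) (lam : nat -> R) (th0 th1 : R) (F : R -> R)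
  (K : R -> Prop) (i : nat -> nat) (v : nat -> R) (z0 : R) :
  lengths_ok d lam -> is_sym_cem d lam th0 th1 F -> (forall k, (i k < d)%nat) ->
  (forall k z, K z -> th0 + psum lam (i k) <= z - z0 + v k < th0 + psum lam (S (i k))) ->
  cong (v 0%nat) z0 ->
  (forall k, cong (v (S k)) (v k + omega d lam (i k) - th0 + th1)) ->
  forall k z, K z -> fiter k F (frac_part z) = frac_part (z - z0 + v k).
Proof.
  intros Hl HF Hi HK H0 HS k z Hz; induction k as [|k IH]; simpl.
  - apply cong_frac; destruct H0 as [m Hm]; exists (- m)%Z; rewrite opp_IZR; lra.
  - rewrite IH, (HF (i k)); [| apply Hi | apply (cem_piece_lift d); auto].
    apply cong_frac.
    destruct (HS k) as [m Hm]; destruct (frac_cong (z - z0 + v k)) as [n Hn].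
    exists (n - m)%Z; rewrite minus_IZR; lra.
Qed.

Definition half_open_arc (c h : R) : R -> Prop :=
  img frac_part (fun z => c - h <= z < c + h).

(** The arc is enlarged until some image touches a break point on each side. The enlarged arc is
    still periodic, so maximality identifies it with [J], and the two contacts become [cc_left] and
    [cc_right]. *)
Lemma periodic_arc_centered (d : nat) (lam : nat -> R) (th0 th1 : R) (F : R -> R)
  (q : nat) (J : R -> Prop) :
  lengths_ok d lam -> (2 <= d)%nat -> is_sym_cem d lam th0 th1 F ->
  periodic_interval arc d (cem_piece lam th0) F q J ->
  exists h i u, centered_cycle d lam th0 th1 q h i u /\
    forall k, seteq (img (fiter k F) J) (half_open_arc (u k) h).
Proof.
  intros Hl Hd HF ((HJ & [x0 Hx0] & _ & Hpc) & Hq & HqJ & _ & Hmax).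
  destruct HJ as (I & HI & HJI).
  destruct (proj1 (HJI x0) Hx0) as (z0 & Hz0 & ->).
  set (i := fun k => proj1_sig (constructive_indefinite_description _ (Hpc k))).
  assert (Hi : forall k, (i k < d)%nat)
    by (intros k; exact (proj1 (proj2_sig (constructive_indefinite_description _ (Hpc k))))).
  assert (Hpiece : forall k z, I z -> cem_piece lam th0 (i k) (fiter k F (frac_part z))).
  { intros k z Hz.
    apply (proj2 (proj2_sig (constructive_indefinite_description _ (Hpc k)))).
    exists (frac_part z); split; [apply HJI; exists z; auto | reflexivity]. }
  clearbody i.
  (* The orbit of the base point, lifted to [[th0, th0 + 1)]. *)
  set (v := fun k => th0 + frac_part (fiter k F (frac_part z0) - th0)).
  assert (Hv : forall k, cong (v k) (fiter k F (frac_part z0))).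
  { intros k; destruct (frac_cong (fiter k F (frac_part z0) - th0)) as [m Hm].
    exists m; unfold v; lra. }
  assert (HS : forall k, cong (v (S k)) (v k + omega d lam (i k) - th0 + th1)).
  { intros k; apply cong_trans with (1 := Hv (S k)); simpl.
    rewrite (HF (i k) _ (Hi k) (Hpiece k z0 Hz0)).
    apply cong_trans with (1 := frac_cong _).
    destruct (Hv k) as [m Hm]; exists (- m)%Z; rewrite opp_IZR; lra. }
  assert (Hv0 : cong (v 0%nat) z0) by (apply cong_trans with (1 := Hv 0%nat), frac_cong).
  assert (Horb : forall k z, I z -> cong (fiter k F (frac_part z)) (z - z0 + v k)).
  { intros k z Hz; induction k as [|k IH]; simpl.
    - apply cong_trans with (1 := frac_cong _); destruct Hv0 as [m Hm].
      exists (- m)%Z; rewrite opp_IZR; lra.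
    - rewrite (HF (i k) _ (Hi k) (Hpiece k z Hz)).
      apply cong_trans with (1 := frac_cong _).
      destruct IH as [m Hm]; destruct (HS k) as [n Hn].
      exists (m - n)%Z; rewrite minus_IZR; lra. }
  assert (Hin : forall k z, I z ->
    th0 + psum lam (i k) <= z - z0 + v k < th0 + psum lam (S (i k))).
  { intros k z Hz.
    apply (convex_in_arc d lam th0 (i k) (fun t => I (t + z0 - v k)) (v k) Hl Hd (Hi k)).
    - intros r s t Hr Ht Hrst; apply (HI (r + z0 - v k) _ (t + z0 - v k)); auto; lra.
    - intros t Ht; destruct (Hpiece k _ Ht) as [_ Hp].
      rewrite (cong_frac _ (t - th0)) in Hp; [exact Hp |].
      apply cong_minus; [| apply cong_refl].
      apply cong_trans with (1 := Horb k _ Ht).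
      replace (t + z0 - v k - z0 + v k) with t by lra; apply cong_refl.
    - replace (v k + z0 - v k) with z0 by lra; exact Hz0.
    - destruct (Hpiece k z0 Hz0) as [_ Hp]; unfold v; lra.
    - replace (z - z0 + v k + z0 - v k) with z by lra; exact Hz. }
  (* On [J] the map [F^q] is a rotation taking [J] onto itself; as [J] is shorter than the circle,
     that rotation is trivial. *)
  assert (Hfix : fiter q F (frac_part z0) = frac_part z0).
  { assert (HvqJ : J (fiter q F (frac_part z0)))
      by (apply HqJ; exists (frac_part z0); split; [exact Hx0 | reflexivity]).
    destruct (proj1 (HJI _) HvqJ) as (z1 & Hz1 & Hvz1).
    assert (Hcq : forall z, I z -> cong (fiter q F (frac_part z)) (z + (z1 - z0))).
    { intros z Hz; apply cong_trans with (1 := Horb q z Hz).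
      pose proof (Horb q z0 Hz0) as H1; rewrite Hvz1 in H1.
      destruct (frac_cong z1) as [m Hm]; destruct H1 as [n Hn].
      exists (m - n)%Z; rewrite minus_IZR; lra. }
    assert (HT : z1 - z0 = 0); [| rewrite Hvz1; f_equal; lra].
    apply (invariant_arc_fixed I (z0 - v 0%nat + (th0 + psum lam (i 0%nat)))
      (z0 - v 0%nat + (th0 + psum lam (S (i 0%nat)))) (z1 - z0) z0 HI).
    - pose proof (arc_length_lt1 d lam (i 0%nat) Hl Hd (Hi 0%nat)); lra.
    - intros z Hz; pose proof (Hin 0%nat z Hz); lra.
    - exact Hz0.
    - replace (z0 + (z1 - z0)) with z1 by lra; exact Hz1.
    - intros z Hz.
      assert (Hj : J (fiter q F (frac_part z))).
      { apply HqJ; exists (frac_part z); split; [apply HJI; exists z; auto | reflexivity]. }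
      destruct (proj1 (HJI _) Hj) as (z' & Hz' & He).
      exists z'; split; [exact Hz' |].
      apply cong_trans with (1 := cong_sym _ _ (Hcq z Hz)); rewrite He; apply frac_cong.
    - intros z' Hz'.
      assert (Hj : J (frac_part z')) by (apply HJI; exists z'; auto).
      destruct (proj2 (HqJ _) Hj) as (x & Hx & He).
      destruct (proj1 (HJI _) Hx) as (z & Hz & ->).
      exists z; split; [exact Hz |].
      apply cong_trans with (1 := cong_sym _ _ (Hcq z Hz)); rewrite <- He; apply frac_cong. }
  assert (Hvper : forall k, v (k + q)%nat = v k)
    by (intros k; unfold v; rewrite fiter_add, Hfix; reflexivity).
  assert (Hvb : forall k, th0 + psum lam (i k) <= v k < th0 + psum lam (S (i k)))
    by (intros k; pose proof (Hin k z0 Hz0); lra).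
  assert (Hiper : forall k, i (k + q)%nat = i k).
  { intros k; pose proof (Hvb k) as H1; pose proof (Hvb (k + q)%nat) as H2.
    rewrite Hvper in H2; apply Nat.le_antisymm.
    - apply (arc_disjoint d lam _ _ (v k - th0) (psum lam (S (i k)))); auto; lra.
    - apply (arc_disjoint d lam _ _ (v k - th0) (psum lam (S (i (k + q)%nat)))); auto; lra. }
  destruct (argmin_periodic (fun k => v k - (th0 + psum lam (i k))) q Hq) as [ka Hka].
  { intros k; rewrite Hvper, Hiper; reflexivity. }
  destruct (argmin_periodic (fun k => th0 + psum lam (S (i k)) - v k) q Hq) as [kb Hkb].
  { intros k; rewrite Hvper, Hiper; reflexivity. }
  pose proof (Hvb ka) as Hva; pose proof (Hvb kb) as Hvb'.
  remember (v ka - (th0 + psum lam (i ka))) as al eqn:Eal.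
  remember (th0 + psum lam (S (i kb)) - v kb) as be eqn:Ebe.
  (* [al] and [be] are the least distances from the orbit of the base point to the left and right
     ends of its elemental arcs, hence the largest extension that keeps the itinerary. *)
  set (K := fun z => z0 - al <= z < z0 + be).
  assert (HKin : forall k z, K z ->
    th0 + psum lam (i k) <= z - z0 + v k < th0 + psum lam (S (i k)))
    by (intros k z [H1 H2]; specialize (Hka k); specialize (Hkb k); cbv beta in *; lra).
  pose proof (cem_orbit d lam th0 th1 F K i v z0 Hl HF Hi HKin Hv0 HS) as HKorb.
  assert (HKJ : seteq (img frac_part K) J).
  { apply Hmax; [split; [| split; [| split]] |].
    - exists K; split; [intros r s t [H1 H2] [H3 H4] Hrst; unfold K; lra | intros x; tauto].
    - exists (frac_part z0), z0; split; [unfold K; lra | reflexivity].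
    - exists q; split; [exact Hq |].
      assert (Hid : forall z, K z -> fiter q F (frac_part z) = frac_part z).
      { intros z Hz; rewrite HKorb by exact Hz; apply cong_frac.
        rewrite <- (Nat.add_0_l q), Hvper.
        destruct Hv0 as [m Hm]; exists m; lra. }
      intros x; split.
      + intros (x' & (z & Hz & ->) & ->); rewrite Hid by exact Hz; exists z; auto.
      + intros (z & Hz & ->); exists (frac_part z); rewrite Hid by exact Hz.
        split; [exists z; auto | reflexivity].
    - intros k; exists (i k); split; [apply Hi |].
      intros x (x' & (z & Hz & ->) & ->); rewrite HKorb by exact Hz.
      apply (cem_piece_lift d); auto.
    - intros x Hx; destruct (proj1 (HJI x) Hx) as (z & Hz & ->).
      exists z; split; [| reflexivity].
      pose proof (Hin ka z Hz); pose proof (Hin kb z Hz); unfold K; lra. }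
  (* The [k]-th image is [[v k - al, v k + be)], whose centre is [v k + (be - al) / 2]. *)
  exists ((al + be) / 2), i, (fun k => v k + (be - al) / 2); split; [split |].
  - exact Hq.
  - lra.
  - pose proof (arc_length_lt1 d lam (i 0%nat) Hl Hd (Hi 0%nat)).
    specialize (Hka 0%nat); specialize (Hkb 0%nat); cbv beta in *; lra.
  - exact Hi.
  - intros k; specialize (Hka k); cbv beta in *; lra.
  - intros k; specialize (Hkb k); cbv beta in *; lra.
  - intros k; destruct (HS k) as [m Hm]; exists m; lra.
  - intros k; rewrite Hvper; reflexivity.
  - exact Hiper.
  - exists ka; lra.
  - exists kb; lra.
  - intros k x; split.
    + intros (x' & Hx' & ->); destruct (proj2 (HKJ x') Hx') as (z & Hz & ->).
      rewrite HKorb by exact Hz; exists (z - z0 + v k); split; [| reflexivity].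
      unfold K in Hz; lra.
    + intros (z & Hz & ->).
      assert (HKz : K (z - v k + z0)) by (unfold K; lra).
      exists (frac_part (z - v k + z0)); split.
      * apply HKJ; exists (z - v k + z0); auto.
      * rewrite HKorb by exact HKz; f_equal; lra.
Qed.

(** * Interiors on the circle and symmetry of periodic arcs of a CEM *)

(** Reflection moves the closed end of a half-open arc to the other side, so the set is only
    squeezed between the open and the closed arc. An endpoint is not interior because the
    complementary gap has length [1 - 2 * h > 0]. *)
Lemma circle_interior_arc (A : R -> Prop) (c h : R) : 0 < h -> 2 * h < 1 ->
  (forall x e, cong x (c + e) -> - h < e < h -> lift A x) ->
  (forall x, lift A x -> exists e, cong x (c + e) /\ - h <= e <= h) ->
  forall x, circle_interior A x <-> exists e, cong x (c + e) /\ - h < e < h.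
Proof.
  intros H0 H1 Hopen Hclosed x; split.
  - intros (eps & Heps & Hx).
    destruct (Hclosed x) as (e & [m Hm] & He).
    { apply Hx; replace (x - x) with 0 by lra; rewrite Rabs_R0; exact Heps. }
    set (r := Rmin eps (1 - 2 * h) / 2).
    assert (Hr : 0 < r /\ r < eps /\ r < 1 - 2 * h).
    { unfold r; pose proof (Rmin_l eps (1 - 2 * h)); pose proof (Rmin_r eps (1 - 2 * h)).
      assert (0 < Rmin eps (1 - 2 * h)) by (apply Rmin_glb_lt; lra); lra. }
    (* No point within [eps] of [x] may lie in the complementary gap; a shift by [r] out of either
       endpoint would produce one. *)
    assert (Hgap : forall s, Rabs s < eps -> h < Rabs (e + s) < 1 - h -> False).
    { intros s Hs Hes.
      destruct (Hclosed (x + s)) as (e' & [n Hn] & He').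
      { apply Hx; replace (x + s - x) with s by lra; exact Hs. }
      assert (Heq : e + s = e').
      { apply cong_eq; [exists (n - m)%Z; rewrite minus_IZR; lra |].
        unfold Rabs in Hes; destruct (Rcase_abs (e + s)); lra. }
      unfold Rabs in Hes; destruct (Rcase_abs (e + s)); lra. }
    exists e; split; [exists m; exact Hm |].
    destruct (Req_dec e h) as [E1 | E1]; [exfalso; apply (Hgap r) |
      destruct (Req_dec e (- h)) as [E2 | E2]; [exfalso; apply (Hgap (- r)) | lra]].
    + rewrite Rabs_right; lra.
    + rewrite Rabs_right; lra.
    + rewrite Rabs_left; lra.
    + rewrite Rabs_left; lra.
  - intros (e & [m Hm] & He).
    exists (Rmin (h - e) (h + e)); split; [apply Rmin_glb_lt; lra |].
    intros z Hz.
    pose proof (Rmin_l (h - e) (h + e)); pose proof (Rmin_r (h - e) (h + e)).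
    apply (Hopen z (e + (z - x))); [exists m; lra |].
    unfold Rabs in Hz; destruct (Rcase_abs (z - x)); lra.
Qed.

Lemma whole_circle_symmetric (th0 th1 : R) (F : R -> R) (J : R -> Prop) :
  seteq (fun x => 0 <= x < 1) J ->
  seteq (circle_interior (img (cem_refl th0 th1) J)) (circle_interior (img (fiter 0 F) J)).
Proof.
  intros HJ.
  assert (HR : forall x, lift (img (cem_refl th0 th1) J) x).
  { intros x; exists (frac_part (- x + th0 + th1)); split; [apply HJ, frac_bounds |].
    apply cong_frac; destruct (frac_cong (- x + th0 + th1)) as [m Hm]; exists m; lra. }
  assert (HI : forall x, lift (img (fiter 0 F) J) x).
  { intros x; exists (frac_part x); split; [apply HJ, frac_bounds | reflexivity]. }
  intros x; split; intros _; exists 1; split; auto; lra.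
Qed.

(** With a single arc [omega] vanishes and [F] is a rotation, so the whole circle is itself a
    periodic arc and maximality leaves no other. *)
Lemma one_arc_periodic (isint : (R -> Prop) -> Prop) (piece : nat -> R -> Prop)
  (lam : nat -> R) (th0 th1 : R) (F : R -> R) :
  lengths_ok 1 lam -> is_sym_cem 1 lam th0 th1 F ->
  isint (fun x => 0 <= x < 1) -> (forall x, 0 <= x < 1 -> piece 0%nat x) ->
  periodic_props isint 1 piece F (fun x => 0 <= x < 1).
Proof.
  intros Hl HF Hint Hpc.
  assert (H1 : psum lam 1 = 1) by apply Hl.
  assert (HFx : forall x, 0 <= x < 1 -> F x = frac_part (x - th0 + th1)).
  { intros x Hx; rewrite (HF 0%nat x); [| lia |].
    - rewrite (omega_eq 1) by exact Hl; rewrite H1; f_equal; simpl psum; lra.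
    - split; [exact Hx |]; rewrite H1; apply frac_bounds. }
  split; [exact Hint | split; [exists 0; lra | split]].
  - exists 1%nat; split; [lia |]; intros x; split.
    + intros (z & Hz & ->); simpl; rewrite HFx by exact Hz; apply frac_bounds.
    + intros Hx; exists (frac_part (x + th0 - th1)); split; [apply frac_bounds |]; simpl.
      rewrite HFx by apply frac_bounds; symmetry; apply frac_eq; [exact Hx |].
      destruct (frac_cong (x + th0 - th1)) as [m Hm].
      exists (- m)%Z; rewrite opp_IZR; lra.
  - intros k; exists 0%nat; split; [lia |]; intros x (z & Hz & ->); apply Hpc.
    induction k as [|k IH]; simpl; [exact Hz | rewrite HFx by exact IH; apply frac_bounds].
Qed.

Lemma cem_periodic_arc_symmetric (d : nat) (lam : nat -> R) (th0 th1 : R) (F : R -> R)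
  (q : nat) (J : R -> Prop) :
  lengths_ok d lam -> (2 <= d)%nat -> is_sym_cem d lam th0 th1 F ->
  periodic_interval arc d (cem_piece lam th0) F q J ->
  exists k : nat,
    seteq (circle_interior (img (cem_refl th0 th1) J))
          (circle_interior (img (fiter k F) J)).
Proof.
  intros Hl Hd HF HJ.
  destruct (periodic_arc_centered d lam th0 th1 F q J Hl Hd HF HJ) as (h & i & u & Hc & Hu).
  destruct (cycle_symmetric d lam th0 th1 q h i u Hl Hc) as [k [m Hm]]; exists k.
  pose proof (cc_h _ _ _ _ _ _ _ _ Hc) as H0; pose proof (cc_h1 _ _ _ _ _ _ _ _ Hc) as H1.
  assert (HJ0 : seteq J (half_open_arc (u 0%nat) h)).
  { intros x; rewrite <- (Hu 0%nat x); split.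
    - intros Hx; exists x; auto.
    - intros (x' & Hx' & ->); exact Hx'. }
  intros x.
  (* Up to endpoints both sets are the arc of radius [h] about [u k], since [u k] is congruent to
     the reflection of [u 0]. *)
  rewrite (circle_interior_arc (img (cem_refl th0 th1) J) (u k) h H0 H1),
    (circle_interior_arc (img (fiter k F) J) (u k) h H0 H1); [tauto | | | |].
  - intros z e [n Hn] He; apply Hu.
    exists (u k + e); split; [lra | apply cong_frac; exists n; exact Hn].
  - intros z Hz; apply Hu in Hz; destruct Hz as (w & Hw & He).
    exists (w - u k); split; [| lra].
    replace (u k + (w - u k)) with w by lra; apply frac_cong_inv; exact He.
  - intros z e [n Hn] He.
    exists (frac_part (u 0%nat - e)); split.
    + apply HJ0; exists (u 0%nat - e); split; [lra | reflexivity].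
    + apply cong_frac; destruct (frac_cong (u 0%nat - e)) as [p Hp].
      exists (p + n + m)%Z; rewrite !plus_IZR; lra.
  - intros z (x' & Hx' & He); apply HJ0 in Hx'; destruct Hx' as (w & Hw & ->).
    apply frac_cong_inv in He; destruct He as [n Hn].
    destruct (frac_cong w) as [p Hp].
    exists (u 0%nat - w); split; [| lra].
    exists (n - p - m)%Z; rewrite !minus_IZR; lra.
Qed.

(** * The IEM as a CEM with zero rotations *)

Lemma iem_is_cem (d : nat) (lam : nat -> R) (F : R -> R) :
  lengths_ok d lam -> is_sym_iem d lam F -> is_sym_cem d lam 0 0 F.
Proof.
  intros Hl HF i x Hi [Hx Hp]; rewrite Rminus_0_r, frac_id in Hp by exact Hx.
  rewrite (HF i x Hi Hp).
  symmetry; apply frac_eq; [| exists 0%Z; lra].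
  rewrite (omega_eq d lam i Hl).
  pose proof (psum_bounds d lam i Hl ltac:(lia)).
  pose proof (psum_bounds d lam (S i) Hl ltac:(lia)); lra.
Qed.

Lemma iem_piece_cem (d : nat) (lam : nat -> R) (i : nat) (x : R) :
  lengths_ok d lam -> (i < d)%nat -> iem_piece lam i x <-> cem_piece lam 0 i x.
Proof.
  intros Hl Hi; unfold iem_piece, cem_piece; rewrite Rminus_0_r.
  pose proof (psum_bounds d lam i Hl ltac:(lia)).
  pose proof (psum_bounds d lam (S i) Hl ltac:(lia)).
  split.
  - intros Hx; rewrite frac_id by lra; lra.
  - intros [Hx Hp]; rewrite frac_id in Hp by exact Hx; exact Hp.
Qed.

Lemma interval01_arc (J : R -> Prop) : interval01 J -> arc J.
Proof.
  intros [HJ Hs]; exists J; split; [exact HJ |]; intros x; split.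
  - intros Hx; exists x; split; [exact Hx | symmetry; apply frac_id, Hs; exact Hx].
  - intros (z & Hz & ->); rewrite frac_id by (apply Hs; exact Hz); exact Hz.
Qed.

(** An arc inside one of at least two elemental intervals cannot wrap through 0: an integer shift of
    its lift is confined to that interval by [convex_in_arc]. *)
Lemma arc_interval01 (d : nat) (lam : nat -> R) (i : nat) (J : R -> Prop) :
  lengths_ok d lam -> (2 <= d)%nat -> (i < d)%nat ->
  arc J -> (exists x, J x) -> subset J (cem_piece lam 0 i) -> interval01 J.
Proof.
  intros Hl Hd Hi (I & HI & HJI) [x0 Hx0] Hs.
  destruct (proj1 (HJI x0) Hx0) as (z0 & Hz0 & ->).
  pose proof (psum_bounds d lam i Hl ltac:(lia)).
  pose proof (psum_bounds d lam (S i) Hl ltac:(lia)).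
  destruct (frac_cong z0) as [m Hm].
  set (K := fun t => I (t - IZR m)).
  assert (HKc : convex_set K)
    by (intros r s t Hr Ht Hrst; apply (HI (r - IZR m) _ (t - IZR m)); auto; lra).
  assert (HKJ : forall t, K t -> J (frac_part t)).
  { intros t Ht; apply HJI; exists (t - IZR m); split; [exact Ht |].
    apply cong_frac; exists m; lra. }
  assert (HKin : forall t, K t -> 0 + psum lam i <= t < 0 + psum lam (S i)).
  { apply (convex_in_arc d lam 0 i K (frac_part z0)); auto.
    - intros t Ht; destruct (Hs _ (HKJ t Ht)) as [_ Hp].
      rewrite Rminus_0_r in *; rewrite frac_id in Hp by apply frac_bounds; exact Hp.
    - unfold K; replace (frac_part z0 - IZR m) with z0 by lra; exact Hz0.
    - destruct (Hs _ Hx0) as [_ Hp].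
      rewrite Rminus_0_r, frac_id in Hp by apply frac_bounds; lra. }
  assert (HJK : seteq J K).
  { intros x; split.
    - intros Hx; destruct (proj1 (HJI x) Hx) as (z & Hz & ->).
      assert (HKz : K (z + IZR m))
        by (unfold K; replace (z + IZR m - IZR m) with z by lra; exact Hz).
      rewrite (frac_eq z (z + IZR m)); [exact HKz | | exists m; reflexivity].
      specialize (HKin _ HKz); lra.
    - intros Hx; rewrite <- (frac_id x); [apply HKJ; exact Hx |].
      specialize (HKin _ Hx); lra. }
  split.
  - intros r s t Hr Ht Hrst; apply HJK, (HKc r s t); auto; apply HJK; assumption.
  - intros x Hx; apply HJK in Hx; specialize (HKin _ Hx); lra.
Qed.

Lemma periodic_props_transfer (int1 int2 : (R -> Prop) -> Prop) (d : nat)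
  (piece1 piece2 : nat -> R -> Prop) (F : R -> R) (J : R -> Prop) :
  (forall i x, (i < d)%nat -> piece1 i x -> piece2 i x) -> int2 J ->
  periodic_props int1 d piece1 F J -> periodic_props int2 d piece2 F J.
Proof.
  intros Hpc HJ (_ & H1 & H2 & H3); split; [exact HJ | split; [exact H1 | split; [exact H2 |]]].
  intros k; destruct (H3 k) as (i & Hi & Hs); exists i; split; [exact Hi |].
  intros x Hx; apply Hpc; auto.
Qed.

Lemma subset_of_props (isint : (R -> Prop) -> Prop) (d : nat) (piece : nat -> R -> Prop)
  (F : R -> R) (J : R -> Prop) :
  periodic_props isint d piece F J -> exists i, (i < d)%nat /\ subset J (piece i).
Proof.
  intros (_ & _ & _ & H); destruct (H 0%nat) as (i & Hi & Hs); exists i; split; [exact Hi |].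
  intros x Hx; apply Hs; exists x; auto.
Qed.

(** Maximality is the delicate point, as the circle admits more competitors. A competitor lies in
    one elemental arc, hence is already an interval. *)
Lemma iem_periodic_cem (d : nat) (lam : nat -> R) (F : R -> R) (q : nat) (J : R -> Prop) :
  lengths_ok d lam -> (2 <= d)%nat ->
  periodic_interval interval01 d (iem_piece lam) F q J ->
  periodic_interval arc d (cem_piece lam 0) F q J.
Proof.
  intros Hl Hd (HP & Hq & HqJ & Hmin & Hmax).
  split; [| split; [exact Hq | split; [exact HqJ | split; [exact Hmin |]]]].
  - apply periodic_props_transfer with (3 := HP).
    + intros i x Hi; apply (iem_piece_cem d); auto.
    + apply interval01_arc, HP.
  - intros J' HJ' Hsub; apply Hmax; [| exact Hsub].
    destruct (subset_of_props _ _ _ _ _ HJ') as (i & Hi & Hs).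
    apply periodic_props_transfer with (3 := HJ').
    + intros j x Hj; apply (iem_piece_cem d); auto.
    + apply (arc_interval01 d lam i); auto; apply HJ'.
Qed.

(** For subsets of [[0,1)] the two interiors can differ only at the cut point 0 and its integer
    translates. *)
Lemma rinterior_circle (A : R -> Prop) (x : R) : (forall z, A z -> 0 <= z < 1) ->
  rinterior A x <-> 0 < x < 1 /\ circle_interior A x.
Proof.
  intros HA; split.
  - intros (e & He & Hx).
    assert (H1 : 0 <= x - e / 2 < 1) by (apply HA, Hx; rewrite Rabs_left; lra).
    assert (H2 : 0 <= x + e / 2 < 1) by (apply HA, Hx; rewrite Rabs_right; lra).
    split; [lra |]; exists e; split; [exact He |]; intros z Hz.
    specialize (Hx z Hz); unfold lift; rewrite frac_id; auto.
  - intros (Hx & e & He & Hl).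
    exists (Rmin e (Rmin x (1 - x))); split; [repeat apply Rmin_glb_lt; lra |].
    intros z Hz.
    pose proof (Rmin_l e (Rmin x (1 - x))); pose proof (Rmin_r e (Rmin x (1 - x))).
    pose proof (Rmin_l x (1 - x)); pose proof (Rmin_r x (1 - x)).
    rewrite <- (frac_id z); [apply Hl; lra |].
    unfold Rabs in Hz; destruct (Rcase_abs (z - x)); lra.
Qed.

Theorem mainTheorem5 :
  (forall (d : nat) (lam : nat -> R) (F : R -> R) (q : nat) (J : R -> Prop),
     lengths_ok d lam -> is_sym_iem d lam F ->
     periodic_interval interval01 d (iem_piece lam) F q J ->
     exists k : nat,
       seteq (rinterior (img iem_refl J)) (rinterior (img (fiter k F) J)))
  /\
  (forall (d : nat) (lam : nat -> R) (th0 th1 : R) (F : R -> R) (q : nat)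
          (J : R -> Prop),
     lengths_ok d lam -> is_sym_cem d lam th0 th1 F ->
     periodic_interval arc d (cem_piece lam th0) F q J ->
     exists k : nat,
       seteq (circle_interior (img (cem_refl th0 th1) J))
             (circle_interior (img (fiter k F) J))).
Proof.
  assert (Hunit : interval01 (fun x => 0 <= x < 1))
    by (split; [intros x y z Hx Hz Hy; lra | intros x Hx; exact Hx]).
  split.
  - intros d lam F q J Hl HF HJ.
    pose proof (iem_is_cem d lam F Hl HF) as HFc.
    assert (Hk : exists k, seteq (circle_interior (img (cem_refl 0 0) J))
                                 (circle_interior (img (fiter k F) J))).
    { destruct (Nat.le_gt_cases 2 d) as [Hd | Hd].
      - apply (cem_periodic_arc_symmetric d lam 0 0 F q J Hl Hd HFc).
        apply iem_periodic_cem; auto.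
      (* With one elemental interval, maximality makes [J] all of [[0,1)]. *)
      - assert (d = 1%nat) by (destruct Hl; lia); subst d.
        assert (H1 : psum lam 1 = 1) by apply Hl.
        destruct HJ as (HP & _ & _ & _ & Hmax).
        exists 0%nat; apply whole_circle_symmetric, Hmax; [| apply HP].
        apply (one_arc_periodic _ _ lam 0 0); auto.
        intros x Hx; unfold iem_piece; rewrite H1; exact Hx. }
    destruct Hk as [k Hk]; exists k; intros x.
    assert (Hrefl : forall A, seteq (img iem_refl A) (img (cem_refl 0 0) A)).
    { assert (Hr : forall w, cem_refl 0 0 w = iem_refl w)
        by (intros w; unfold cem_refl, iem_refl; rewrite !Rplus_0_r; reflexivity).
      intros A z; split; intros (w & Hw & ->); exists w; rewrite Hr; auto. }
    assert (Hint : rinterior (img iem_refl J) x <-> rinterior (img (cem_refl 0 0) J) x).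
    { split; intros (e & He & Hx); exists e; split; auto; intros z Hz; apply Hrefl; auto. }
    (* Both images lie in [[0,1)], so equality of circle interiors restricts to the line. *)
    rewrite Hint, !rinterior_circle, (Hk x); [tauto | |].
    + intros z Hz; destruct HJ as ((_ & _ & _ & Hpc) & _).
      destruct (Hpc k) as (i & Hi & Hs).
      apply (iem_piece_cem d lam i z Hl Hi), Hs; exact Hz.
    + intros z (w & _ & ->); apply frac_bounds.
  - intros d lam th0 th1 F q J Hl HF HJ.
    destruct (Nat.le_gt_cases 2 d) as [Hd | Hd];
      [apply (cem_periodic_arc_symmetric d lam th0 th1 F q J Hl Hd HF HJ) |].
    assert (d = 1%nat) by (destruct Hl; lia); subst d.
    assert (H1 : psum lam 1 = 1) by apply Hl.
    destruct HJ as (HP & _ & _ & _ & Hmax).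
    exists 0%nat; apply whole_circle_symmetric, Hmax.
    + apply (one_arc_periodic _ _ lam th0 th1); auto; [apply interval01_arc, Hunit |].
      intros x Hx; split; [exact Hx | rewrite H1; apply frac_bounds].
    + destruct (subset_of_props _ _ _ _ _ HP) as (i & Hi & Hs).
      intros x Hx; apply Hs in Hx; apply Hx.
Qed.
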